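(* Let $a=1+\sqrt2$ and let $$A=\left(\begin{array}{cccccccc} 0&1&a&1+a&1+a&a&1&0\\ 0&0&1&a&1+a&1+a&a&1\\ 1&0&0&1&a&1+a&1+a&a\\ a&1&0&0&1&a&1+a&1+a\\ 1+a&a&1&0&0&1&a&1+a\\ 1+a&1+a&a&1&0&0&1&a\\ a&1+a&1+a&a&1&0&0&1\\ 1&a&1+a&1+a&a&1&0&0 \end{array}\right).$$ Then $\operatorname{rank}(A)=3$ and $\operatorname{rank}_+(A^2)=4$. Consequently, the inequality $\operatorname{rank}_+(A^2)\le\operatorname{rank}(A)$ does not hold for all nonnegative $n\times n$ matrices $A$.
   Context: For an entrywise nonnegative matrix $M\in\mathbb{R}^{m\times n}_+$, the nonnegative rank $\operatorname{rank}_+(M)$ is the minimum $k$ such that there exist entrywise nonnegative $U\in\mathbb{R}^{m\times k}_+$, $V\in\mathbb{R}^{k\times n}_+$ with $M=UV$. *)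

(* Defs.v *)
From HB Require Import structures.
From mathcomp Require Import all_boot all_order all_algebra.
From mathcomp Require Import boolp reals.

Set Implicit Arguments.
Unset Strict Implicit.
Unset Printing Implicit Defensive.

Import Order.TTheory GRing.Theory Num.Theory.
Local Open Scope ring_scope.

Definition nonneg_mx (R : realType) (m n : nat) (M : 'M[R]_(m, n)) : Prop :=
  forall i j, 0 <= M i j.

Definition nonneg_factorization (R : realType) (m n : nat) (M : 'M[R]_(m, n))
    (k : nat) : Prop :=
  exists (U : 'M[R]_(m, k)) (V : 'M[R]_(k, n)),
    [/\ nonneg_mx U, nonneg_mx V & M = U *m V].

Lemma nonneg_factorization_ncols (R : realType) (m n : nat)
    (M : 'M[R]_(m, n)) :
  exists k, `[< nonneg_mx M -> nonneg_factorization M k >].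
Proof.
exists n; apply/asboolP => M0; exists M, 1%:M; split => //; last first.
  by rewrite mulmx1.
by move=> i j; rewrite mxE; case: (_ == _).
Qed.

(* The nonnegative rank is only meaningful when M is nonnegative; the guard   *)
(* makes the function total, with value 0 on the other matrices.              *)
Definition nonneg_rank (R : realType) (m n : nat) (M : 'M[R]_(m, n)) : nat :=
  ex_minn (nonneg_factorization_ncols M).

Lemma nonneg_rankP (R : realType) (m n : nat) (M : 'M[R]_(m, n)) :
  nonneg_mx M ->
  nonneg_factorization M (nonneg_rank M) /\
  (forall k, nonneg_factorization M k -> (nonneg_rank M <= k)%N).
Proof.
move=> M0; rewrite /nonneg_rank; case: ex_minnP => r /asboolP rP rmin.
split; first exact: rP.
by move=> k kP; apply: rmin; apply/asboolP.
Qed.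

Definition mx_of_rows (R : realType) (m n : nat) (rows : seq (seq R)) :
    'M[R]_(m, n) :=
  \matrix_(i < m, j < n) nth 0 (nth [::] rows i) j.

Definition octagon_mx (R : realType) : 'M[R]_8 :=
  let a : R := 1 + Num.sqrt 2 in
  mx_of_rows 8 8
  [:: [:: 0;     1;     a;     1 + a; 1 + a; a;     1;     0    ];
      [:: 0;     0;     1;     a;     1 + a; 1 + a; a;     1    ];
      [:: 1;     0;     0;     1;     a;     1 + a; 1 + a; a    ];
      [:: a;     1;     0;     0;     1;     a;     1 + a; 1 + a];
      [:: 1 + a; a;     1;     0;     0;     1;     a;     1 + a];
      [:: 1 + a; 1 + a; a;     1;     0;     0;     1;     a    ];
      [:: a;     1 + a; 1 + a; a;     1;     0;     0;     1    ];
      [:: 1;     a;     1 + a; 1 + a; a;     1;     0;     0    ]].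

(* Main.v *)
(* The square of A has rank 3, with entries proportional to                   *)
(* 1 + k <e_i, e_(j+1)> where e_i = (cos (i pi / 4), sin (i pi / 4)) and      *)
(* k = 2 - sqrt 2. A size-3 nonnegative factorization is a triangle between   *)
(* the regular octagon with vertices k e_j and the octagon <e_i, x> >= -1.    *)
(* The circumradius of the outer octagon is exactly twice the inradius of the *)
(* inner one, so by the equality case of Euler's inequality R >= 2 r the      *)
(* triangle would be equilateral with its vertices among those of the outer   *)
(* octagon, which is impossible. The square with vertices e_0, e_2, e_4, e_6  *)
(* lies between the two octagons and gives a factorization of size 4.         *)

Require Import Defs.
From HB Require Import structures.
From mathcomp Require Import all_boot all_order all_algebra.
From mathcomp Require Import ring lra.
From mathcomp Require Import boolp reals.

Set Implicit Arguments.
Unset Strict Implicit.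
Unset Printing Implicit Defensive.

Import Order.TTheory GRing.Theory Num.Theory.
Local Open Scope ring_scope.

(** [octagon_mx] and its square factor through dimension 3 with an invertible core, so both have
    rank 3. A size-3 nonnegative factorization of the square yields, by [full_rank_factorization]
    and [octcone_row], vectors w_k and z_k in an octagonal cone that are biorthogonal for a diagonal
    form. Euler's inequality becomes a trace argument: each product of the first coordinates of z_k
    and w_k is at least a third of a constant e ([octcone_dual_ge]), while the three products sum to
    e. Equality makes w_k a vertex direction proportional to z_k ([octcone_dual_eq]), so distinct
    w_k are orthogonal for the form, against [octvertex_angle]. *)

(** * Factorizations through a full-rank core *)

Section FullRankSandwich.
Variables (F : fieldType) (m n p : nat).
Variables (L : 'M[F]_(m, n)) (Li : 'M[F]_(n, m)).
Variables (R : 'M[F]_(n, p)) (Ri : 'M[F]_(p, n)).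
Hypotheses (LiL : Li *m L = 1%:M) (RRi : R *m Ri = 1%:M).

Lemma mxrank_sandwich (D : 'M[F]_n) :
  D \in unitmx -> \rank (L *m D *m R) = n.
Proof.
move=> Du; apply/eqP; rewrite eqn_leq; apply/andP; split.
  by apply: leq_trans (mxrankM_maxl _ _) _; apply: rank_leq_col.
have DE : D = Li *m (L *m D *m R) *m Ri.
  by rewrite !mulmxA LiL mul1mx -mulmxA RRi mulmx1.
rewrite -{1}(mxrank_unit Du) {1}DE.
exact: leq_trans (mxrankM_maxl _ _) (mxrankM_maxr _ _).
Qed.

(** With W = Li U and Z = V Ri, the square identity W Z = D gives Z Di W = 1; inserting this
    identity next to U or V turns U V into L D R. *)
Lemma full_rank_factorization (D Di : 'M[F]_n) (U : 'M[F]_(m, n))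
    (V : 'M[F]_(n, p)) :
  D *m Di = 1%:M -> U *m V = L *m D *m R ->
  exists W Z : 'M[F]_n,
    [/\ U = L *m W, V = Z *m R, W *m Z = D & Z *m Di *m W = 1%:M].
Proof.
move=> DDi UV; exists (Li *m U), (V *m Ri).
have WZ : Li *m U *m (V *m Ri) = D.
  by rewrite -mulmxA (mulmxA U) UV !mulmxA LiL mul1mx -mulmxA RRi mulmx1.
have ZW : V *m Ri *m Di *m (Li *m U) = 1%:M.
  by apply: mulmx1C; rewrite mulmxA WZ.
split => //.
  rewrite -[LHS]mulmx1 -ZW !mulmxA UV -(mulmxA (L *m D)) RRi mulmx1.
  by rewrite -(mulmxA L) DDi mulmx1.
rewrite -[LHS]mul1mx -ZW -!mulmxA UV !mulmxA -(mulmxA _ Li) LiL mulmx1.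
by rewrite -(mulmxA _ Di) (mulmx1C DDi) mulmx1.
Qed.

End FullRankSandwich.

(** * Extremal geometry of the octagonal cone *)

Section OctagonCone.
Variables (F : realFieldType) (s : F).
Hypotheses (ss : s * s = 2) (s_bounds : 7 / 5 < s < 3 / 2).

(* The cone over the regular octagon |x| <= 1, |y| <= 1, |x| + |y| <= sqrt 2. *)
Definition octcone (x0 x1 x2 : F) : Prop :=
  [/\ `|x1| <= x0, `|x2| <= x0 & `|x1| + `|x2| <= s * x0].

Lemma octcone_ge0 x0 x1 x2 : octcone x0 x1 x2 -> 0 <= x0.
Proof. by case=> h _ _; apply: le_trans h. Qed.

Lemma octcone0 x1 x2 : octcone 0 x1 x2 -> x1 = 0 /\ x2 = 0.
Proof. by case; rewrite !normr_le0 => /eqP-> /eqP->. Qed.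

(* The vertices are (+-1, +-(s - 1)) and (+-(s - 1), +-1), and                *)
(* (s - 1)^2 = 3 - 2 * s.                                                     *)
Definition octvertex (x0 x1 x2 : F) : Prop :=
  (x1 ^+ 2 = x0 ^+ 2 /\ x2 ^+ 2 = (3 - 2 * s) * x0 ^+ 2) \/
  (x2 ^+ 2 = x0 ^+ 2 /\ x1 ^+ 2 = (3 - 2 * s) * x0 ^+ 2).

(** Only the vertices of an octagon are farthest from its centre; here the squared circumradius is 1
    + (s - 1)^2 = 4 - 2 * s. *)
Lemma octcone_sqr_le x0 x1 x2 : octcone x0 x1 x2 ->
  x1 ^+ 2 + x2 ^+ 2 <= (4 - 2 * s) * x0 ^+ 2 /\
  (x1 ^+ 2 + x2 ^+ 2 = (4 - 2 * s) * x0 ^+ 2 -> octvertex x0 x1 x2).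
Proof.
wlog le21 : x1 x2 / `|x2| <= `|x1| => [base|].
  have [|/ltW le12 [h1 h2 h3]] := leP `|x2| `|x1|; first exact: base.
  have [] := base x2 x1 le12; first by split=> //; rewrite addrC.
  rewrite addrC => h h'; split=> // /h' []; by [right|left].
move=> cx; have x0_ge0 := octcone_ge0 cx; case: cx => le10 _ le120.
rewrite /octvertex -![x1 ^+ 2]real_normK ?num_real //.
rewrite -![x2 ^+ 2]real_normK ?num_real //.
move: (normr_ge0 x1) (normr_ge0 x2) le21 le10 le120.
move: `|x1| `|x2| => X Y X0 Y0 leYX leX le120.
case/andP: s_bounds => s_lo s_hi.
(* The gap in the bound is the sum of these two products, modulo s^2 = 2. *)
have g1 : 0 <= ((s - 1) * x0 + Y) * (s * x0 - X - Y).
  by apply: mulr_ge0; [apply: addr_ge0 => //; apply: mulr_ge0 => //|]; lra.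
have g2 : 0 <= (x0 - X) * ((2 - s) * x0 + (X - Y)).
  apply: mulr_ge0; first lra.
  by apply: addr_ge0; [apply: mulr_ge0 => //|]; lra.
have e : (4 - 2 * s) * x0 ^+ 2 - (X ^+ 2 + Y ^+ 2) =
    ((s - 1) * x0 + Y) * (s * x0 - X - Y) +
    (x0 - X) * ((2 - s) * x0 + (X - Y)).
  apply/eqP; rewrite -subr_eq0; apply/eqP.
  transitivity ((2 - s * s) * x0 ^+ 2); last by rewrite ss subrr mul0r.
  ring.
split=> [|eqn]; first by rewrite -subr_ge0 e addr_ge0.
left; suff XE : X = x0 by split; [rewrite XE | move: eqn; rewrite XE; lra].
have /eqP : (x0 - X) * ((2 - s) * x0 + (X - Y)) = 0.
  by move: e; rewrite eqn; lra.
rewrite mulf_eq0 => /orP[/eqP|/eqP z]; first lra.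
have : 0 <= (3 / 2 - s) * x0 by apply: mulr_ge0; lra.
by lra.
Qed.

(** Cauchy-Schwarz and the circumradius bound the planar product by (4 - 2 * s) * (y0 * x0); as (2 +
    s) / 2 * (4 - 2 * s) = 2, this gives e <= 3 * (y0 * x0). *)
Lemma octcone_dual_ge x0 x1 x2 y0 y1 y2 e :
  octcone x0 x1 x2 -> octcone y0 y1 y2 -> 0 < e ->
  y0 * x0 + (2 + s) / 2 * (y1 * x1 + y2 * x2) = e ->
  0 < y0 /\ 0 < x0 /\ e / 3 <= y0 * x0.
Proof.
move=> cx cy e0 E; have x0_ge0 := octcone_ge0 cx; have y0_ge0 := octcone_ge0 cy.
have y0_gt0 : 0 < y0.
  rewrite lt_neqAle y0_ge0 andbT; apply/eqP => y0E.
  by move: cy E; rewrite -y0E => /octcone0[-> ->]; lra.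
have x0_gt0 : 0 < x0.
  rewrite lt_neqAle x0_ge0 andbT; apply/eqP => x0E.
  by move: cx E; rewrite -x0E => /octcone0[-> ->]; lra.
have [[lx _] [ly _]] := (octcone_sqr_le cx, octcone_sqr_le cy).
split=> //; split=> //; case/andP: s_bounds => s_lo s_hi.
have q0 : 0 < y0 * x0 by apply: mulr_gt0.
have h : y0 * x0 * (y1 * x1 + y2 * x2) <= y0 * x0 * ((4 - 2 * s) * (y0 * x0)).
  have := ler_wpM2l (sqr_ge0 y0) lx; have := ler_wpM2l (sqr_ge0 x0) ly.
  have := sqr_ge0 (y0 * x1 - x0 * y1); have := sqr_ge0 (y0 * x2 - x0 * y2).
  by lra.
rewrite ler_pM2l // in h.
have s2 : 0 <= (2 + s) / 2 by lra.
have := ler_wpM2l s2 h.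
have -> : (2 + s) / 2 * ((4 - 2 * s) * (y0 * x0)) = (4 - s * s) * (y0 * x0).
  by field.
rewrite ss; lra.
Qed.

(** Equality in Cauchy-Schwarz gives proportionality, and equality in the circumradius bound gives a
    vertex. *)
Lemma octcone_dual_eq x0 x1 x2 y0 y1 y2 e :
  octcone x0 x1 x2 -> octcone y0 y1 y2 -> 0 < e ->
  y0 * x0 + (2 + s) / 2 * (y1 * x1 + y2 * x2) = e ->
  y0 * x0 = e / 3 ->
  [/\ y0 * x1 = x0 * y1, y0 * x2 = x0 * y2 & octvertex x0 x1 x2].
Proof.
move=> cx cy e0 E Ee; have [y0_gt0 [x0_gt0 _]] := octcone_dual_ge cx cy e0 E.
have [[lx vx] [ly _]] := (octcone_sqr_le cx, octcone_sqr_le cy).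
have dotE : y1 * x1 + y2 * x2 = (4 - 2 * s) * (y0 * x0).
  have E2 : (2 + s) / 2 * (y1 * x1 + y2 * x2) = 2 * (y0 * x0) by lra.
  have := congr1 (fun u => (4 - 2 * s) * u) E2.
  have -> : (4 - 2 * s) * ((2 + s) / 2 * (y1 * x1 + y2 * x2)) =
     (4 - s * s) * (y1 * x1 + y2 * x2) by field.
  by rewrite ss; lra.
have lx' := ler_wpM2l (sqr_ge0 y0) lx.
have {}ly := ler_wpM2l (sqr_ge0 x0) ly.
have dotE' := congr1 (fun u => y0 * x0 * u) dotE; rewrite /= in dotE'.
have s1 := sqr_ge0 (y0 * x1 - x0 * y1); have s2 := sqr_ge0 (y0 * x2 - x0 * y2).
have z1 : (y0 * x1 - x0 * y1) ^+ 2 = 0 by lra.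
have z2 : (y0 * x2 - x0 * y2) ^+ 2 = 0 by lra.
move/eqP: z1; rewrite sqrf_eq0 subr_eq0 => /eqP z1.
move/eqP: z2; rewrite sqrf_eq0 subr_eq0 => /eqP z2.
split=> //; apply: vx; apply: (mulfI (lt0r_neq0 (exprn_gt0 2 y0_gt0))).
by lra.
Qed.

(* The vertices of the octagon are at 45 degrees from each other, whereas the *)
(* scalar product below corresponds to an angle of 120 degrees.               *)
Lemma octvertex_angle x0 x1 x2 y0 y1 y2 :
  0 < x0 -> 0 < y0 -> octvertex x0 x1 x2 -> octvertex y0 y1 y2 ->
  x0 * y0 + (2 + s) / 2 * (x1 * y1 + x2 * y2) != 0.
Proof.
move=> x0_gt0 y0_gt0 vx vy; apply/eqP => E.
have m0 : 0 < x0 * y0 by apply: mulr_gt0.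
case/andP: s_bounds => s_lo s_hi.
have {E} : x1 * y1 + x2 * y2 = - (2 - s) * (x0 * y0).
  have := congr1 (fun u => (2 - s) * u) E.
  have -> : (2 - s) * (x0 * y0 + (2 + s) / 2 * (x1 * y1 + x2 * y2)) =
     (2 - s) * (x0 * y0) + (4 - s * s) / 2 * (x1 * y1 + x2 * y2) by field.
  by rewrite ss; lra.
have pm (a b : F) : a ^+ 2 = b ^+ 2 -> a = b \/ a = - b.
  by move/eqP; rewrite eqf_sqr => /orP[] /eqP; [left|right].
have tt : 3 - 2 * s = (s - 1) ^+ 2 by rewrite expr2 mulrBl mulrBr ss; lra.
have : ((x1 * y1) ^+ 2 = (x0 * y0) ^+ 2 /\
        (x2 * y2) ^+ 2 = ((3 - 2 * s) * (x0 * y0)) ^+ 2) \/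
       ((x2 * y2) ^+ 2 = (x0 * y0) ^+ 2 /\
        (x1 * y1) ^+ 2 = ((3 - 2 * s) * (x0 * y0)) ^+ 2) \/
       ((x1 * y1) ^+ 2 = ((s - 1) * (x0 * y0)) ^+ 2 /\
        (x2 * y2) ^+ 2 = ((s - 1) * (x0 * y0)) ^+ 2).
  rewrite !exprMn -tt.
  case: vx => -[-> ->]; case: vy => -[-> ->];
    [left|right; right|right; right|right; left]; split; ring.
have lo : 0 < x0 * y0 * (s - 7 / 5) by apply: mulr_gt0 => //; lra.
have hi : 0 < x0 * y0 * (3 / 2 - s) by apply: mulr_gt0 => //; lra.
move: (x0 * y0) (x1 * y1) (x2 * y2) m0 lo hi => m p q m0 lo hi.
(* The possible values of (p + q) / m are 0, +-(2 * s - 2) and +-(4 - 2 * s), never -(2 - s). *)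
by move=> [[/pm[]-> /pm[]->]|[[/pm[]-> /pm[]->]|[/pm[]-> /pm[]->]]]; lra.
Qed.

End OctagonCone.

(** * The octagon matrix and its square in trigonometric form *)

Section Octagon.
Variable R : realType.

Let s : R := Num.sqrt 2.

Lemma sqr_sqrt2 : s * s = 2.
Proof. by rewrite -expr2 sqr_sqrtr. Qed.

Lemma cube_sqrt2 : s * s * s = 2 * s.
Proof. by rewrite sqr_sqrt2. Qed.

Lemma sqrt2_bounds : 7 / 5 < s < 3 / 2.
Proof.
have s0 : 0 <= s by apply: sqrtr_ge0.
have ss := sqr_sqrt2; apply/andP; split; nra.
Qed.

(* [octcos k] is cos (k pi / 4), so [octcos (k + 6)] is sin (k pi / 4). *)
Definition octcos (k : nat) : R :=
  nth 0 [:: 1; s / 2; 0; - (s / 2); - 1; - (s / 2); 0; s / 2] (k %% 8).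

Definition octrows (r : nat) : 'M[R]_(8, 3) :=
  \matrix_(i, j) nth 0 [:: 1; octcos (i + r); octcos (i + r + 6)] j.

(** The columns of [octrows r] are orthogonal with squared norms 8, 4, 4, so this rescaled transpose
    is a left inverse. *)
Definition octpinv (r : nat) : 'M[R]_(3, 8) :=
  \matrix_(i, j) (octrows r j i / nth 0 [:: 8; 4; 4] i).

(* With t_i = i pi / 4, the entries of A are                                  *)
(* (2 + s) / 2 * (1 - cos (t_j - t_i) + (s - 1) * sin (t_j - t_i)).           *)
Definition octcore : 'M[R]_3 := mx_of_rows 3 3
  [:: [:: (2 + s) / 2; 0; 0];
      [:: 0; - ((2 + s) / 2); s / 2];
      [:: 0; - (s / 2); - ((2 + s) / 2)]].

Definition octcore_inv : 'M[R]_3 := mx_of_rows 3 3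
  [:: [:: 2 - s; 0; 0];
      [:: 0; - (1 / 2); - ((s - 1) / 2)];
      [:: 0; (s - 1) / 2; - (1 / 2)]].

Definition sqcore : 'M[R]_3 := mx_of_rows 3 3
  [:: [:: 12 + 8 * s; 0; 0]; [:: 0; 8 + 4 * s; 0]; [:: 0; 0; 8 + 4 * s]].

Definition sqcore_inv : 'M[R]_3 := mx_of_rows 3 3
  [:: [:: (3 - 2 * s) / 4; 0; 0]; [:: 0; (2 - s) / 8; 0];
      [:: 0; 0; (2 - s) / 8]].

Ltac expand_entries i j :=
  do 8? [case: i => [|i]]; rewrite ?ltnS ?ltn0 // => ?;
  do 8? [case: j => [|j]]; rewrite ?ltnS ?ltn0 // => ?;
  rewrite !(mxE, big_ord_recr, big_ord0) /= /octcos /=.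

Ltac entries :=
  apply/matrixP; have := sqr_sqrt2; have := cube_sqrt2;
  let h3 := fresh in let h2 := fresh in let i := fresh in let j := fresh in
  move=> h3 h2 [i +] [j +]; expand_entries i j; lra.

Lemma octpinvK : octpinv 0 *m octrows 0 = 1%:M.
Proof. entries. Qed.

Lemma octpinv1K : octpinv 1 *m octrows 1 = 1%:M.
Proof. entries. Qed.

Lemma octcoreK : octcore *m octcore_inv = 1%:M.
Proof. entries. Qed.

Lemma sqcoreK : sqcore *m sqcore_inv = 1%:M.
Proof. entries. Qed.

Definition octgram : 'M[R]_3 :=
  mx_of_rows 3 3 [:: [:: 8; 0; 0]; [:: 0; 4; 0]; [:: 0; 0; 4]].

Lemma octgramE : (octrows 0)^T *m octrows 0 = octgram.
Proof. entries. Qed.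

Definition octcore_sqr : 'M[R]_3 := mx_of_rows 3 3
  [:: [:: 12 + 8 * s; 0; 0];
      [:: 0; 4 + 4 * s; - (4 + 4 * s)];
      [:: 0; 4 + 4 * s; 4 + 4 * s]].

Lemma octcore_gram :
  octcore *m octgram = mx_of_rows 3 3
    [:: [:: 8 + 4 * s; 0; 0]; [:: 0; - (4 + 2 * s); 2 * s];
        [:: 0; - (2 * s); - (4 + 2 * s)]].
Proof. entries. Qed.

Lemma octcore_sqrE : octcore *m octgram *m octcore = octcore_sqr.
Proof. rewrite octcore_gram. entries. Qed.

(** The lower block of [octcore_sqr] is 8 + 4 * s times the rotation by 45 degrees, which moves each
    octagon direction to the next. *)
Lemma octcore_sqr_rot :
  octcore_sqr *m (octrows 0)^T = sqcore *m (octrows 1)^T.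
Proof. entries. Qed.

Lemma octrows_core :
  octrows 0 *m octcore = \matrix_(i < 8, j < 3) nth 0
    [:: (2 + s) / 2;
        - ((2 + s) / 2 * octcos i) - s / 2 * octcos (i + 6);
        s / 2 * octcos i - (2 + s) / 2 * octcos (i + 6)] j.
Proof.
apply/matrixP => i [[|[|[|j]]] lt_j] //;
  rewrite !(mxE, big_ord_recr, big_ord0) /= addn0; ring.
Qed.

Lemma octagon_mxE : octagon_mx R = octrows 0 *m octcore *m (octrows 0)^T.
Proof. rewrite octrows_core /octagon_mx -/s. entries. Qed.

Lemma octagon_mx_sqrE :
  octagon_mx R ^+ 2 = octrows 0 *m sqcore *m (octrows 1)^T.
Proof.
rewrite expr2 -[LHS]/(octagon_mx R *m octagon_mx R) octagon_mxE.
rewrite -[RHS]mulmxA -octcore_sqr_rot -octcore_sqrE -octgramE !mulmxA.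
by [].
Qed.

Lemma tr_octpinv1K : (octrows 1)^T *m (octpinv 1)^T = 1%:M.
Proof. by rewrite -trmx_mul octpinv1K trmx1. Qed.

Lemma mxrank_octagon : \rank (octagon_mx R) = 3%N.
Proof.
rewrite octagon_mxE; apply: (mxrank_sandwich (Ri := (octpinv 0)^T)).
- exact: octpinvK.
- by rewrite -trmx_mul octpinvK trmx1.
- by have /mulmx1_unit[] := octcoreK.
Qed.

Lemma mxrank_octagon_sqr : \rank (octagon_mx R ^+ 2) = 3%N.
Proof.
rewrite octagon_mx_sqrE.
apply: (mxrank_sandwich octpinvK tr_octpinv1K).
by have /mulmx1_unit[] := sqcoreK.
Qed.

Lemma octagon_mx_ge0 : nonneg_mx (octagon_mx R).
Proof.
case/andP: sqrt2_bounds => s_lo s_hi.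
rewrite /octagon_mx -/s => -[i +] [j +].
expand_entries i j; lra.
Qed.

Lemma octagon_mx_sqr_ge0 : nonneg_mx (octagon_mx R ^+ 2).
Proof.
move=> i j; rewrite expr2 mxE; apply: sumr_ge0 => k _.
by apply: mulr_ge0; apply: octagon_mx_ge0.
Qed.

(** * No nonnegative factorization of size 3 *)

Lemma octcone_row (w0 w1 w2 : R) :
  (forall k, (k < 8)%N -> 0 <= w0 + octcos k * w1 + octcos (k + 6) * w2) ->
  octcone s w0 w1 w2.
Proof.
move=> h; case/andP: sqrt2_bounds => s_lo s_hi.
(* Multiplying by s turns the diagonal conditions (odd k) into s * w0 +- w1 +- w2 >= 0. *)
have scaled : forall k, (k < 8)%N ->
    0 <= s * (w0 + octcos k * w1 + octcos (k + 6) * w2).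
  by move=> k /h ?; apply: mulr_ge0 => //; lra.
have := (h 0 isT, h 2 isT, h 4 isT, h 6 isT)%N.
have := (scaled 1 isT, scaled 3 isT, scaled 5 isT, scaled 7 isT)%N.
rewrite /octcos /= -/s => -[[[]]] d1 d3 d5 d7 [[[]]] c0 c2 c4 c6.
have e1 := congr1 (fun u => u * w1) sqr_sqrt2.
have e2 := congr1 (fun u => u * w2) sqr_sqrt2.
rewrite /= in e1 e2.
by split; do ?case: ler0P => _; lra.
Qed.

Lemma sum_ord3 (F : 'I_3 -> R) :
  \sum_j F j =
  F (@Ordinal 3 0 isT) + F (@Ordinal 3 1 isT) + F (@Ordinal 3 2 isT).
Proof.
rewrite !big_ord_recr big_ord0 /= add0r.
by congr (F _ + F _ + F _); apply: val_inj.
Qed.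

Lemma octagon_sqr_no_factorization3 :
  ~ nonneg_factorization (octagon_mx R ^+ 2) 3.
Proof.
case=> U [V [U0 V0]]; rewrite octagon_mx_sqrE => UV.
have [W [Z [UE VE WZ ZW]]] :=
  full_rank_factorization octpinvK tr_octpinv1K sqcoreK (esym UV).
set o0 := @Ordinal 3 0 isT; set o1 := @Ordinal 3 1 isT.
set o2 := @Ordinal 3 2 isT.
have cW k : octcone s (W o0 k) (W o1 k) (W o2 k).
  apply: octcone_row => i lt_i; have := U0 (Ordinal lt_i) k.
  by rewrite UE mxE sum_ord3 !mxE /= addn0 mul1r.
have cZ k : octcone s (Z k o0) (Z k o1) (Z k o2).
  apply: octcone_row => i lt_i.
  (* Shifting the index by 7, that is by -1 modulo 8, undoes the rotation in [octrows 1]. *)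
  have lt_i' : ((i + 7) %% 8 < 8)%N by rewrite ltn_mod.
  have shift c : octcos ((i + 7) %% 8 + 1 + c) = octcos (i + c).
    by rewrite /octcos -addnA modnDml (addnC 1) addnACA (modnDr _ 8).
  have := V0 k (Ordinal lt_i').
  rewrite VE mxE sum_ord3 !mxE /= mulr1 ![Z k _ * _]mulrC.
  by rewrite shift -[(_ + 1)%N]addn0 shift addn0.
(* Scaling by 12 + 8 * s turns the diagonal of [sqcore_inv] into 1, (2 + s) / 2, (2 + s) / 2. *)
have D k l : Z k o0 * W o0 l + (2 + s) / 2 * (Z k o1 * W o1 l + Z k o2 * W o2 l)
    = (12 + 8 * s) *+ (k == l).
  have := congr1 (fun M : 'M[R]_3 => (12 + 8 * s) * M k l) ZW.
  rewrite /= mxE !sum_ord3 !mxE !sum_ord3 !mxE /= -/s -/o0 -/o1 -/o2.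
  rewrite mulr_natr => <-.
  have e (u : R) := congr1 (fun v => v * u) sqr_sqrt2.
  have := (e (Z k o0 * W o0 l), e (Z k o1 * W o1 l), e (Z k o2 * W o2 l)).
  by move=> /= [[]]; lra.
have T : \sum_k Z k o0 * W o0 k = 12 + 8 * s.
  have := congr1 (fun M : 'M[R]_3 => M o0 o0) WZ.
  rewrite /= !mxE /= -/s => <-.
  by apply: eq_bigr => k _; rewrite mulrC.
case/andP: sqrt2_bounds => s_lo s_hi.
have e0 : 0 < 12 + 8 * s by lra.
have Dk k : Z k o0 * W o0 k + (2 + s) / 2 * (Z k o1 * W o1 k + Z k o2 * W o2 k)
    = 12 + 8 * s by rewrite D eqxx.
have ge k := octcone_dual_ge sqr_sqrt2 sqrt2_bounds (cW k) (cZ k) e0 (Dk k).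
(* Three terms, each at least a third of their sum, are all equal to that third. *)
have eq3 k : (k == o0) || (k == o1) -> Z k o0 * W o0 k = (12 + 8 * s) / 3.
  move: T (ge o0) (ge o1) (ge o2); rewrite sum_ord3 -/o0 -/o1 -/o2.
  by move=> T [_ [_ g0]] [_ [_ g1]] [_ [_ g2]] /orP[] /eqP ->; lra.
have dual_eq k :=
  octcone_dual_eq sqr_sqrt2 sqrt2_bounds (cW k) (cZ k) e0 (Dk k).
have [a1 a2 v0] := dual_eq o0 (eq3 o0 isT).
have [_ _ v1] := dual_eq o1 (eq3 o1 isT).
have [z0 [w0 _]] := ge o0; have [_ [w1 _]] := ge o1.
(* Row 0 of [Z] is proportional to column 0 of [W], so [D o0 o1] makes columns 0 and 1 of [W]
   orthogonal for the form. *)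
have /eqP[] := octvertex_angle sqr_sqrt2 sqrt2_bounds w0 w1 v0 v1.
apply: (mulfI (lt0r_neq0 z0)); rewrite mulr0.
have := D o0 o1; rewrite mulr0n => /(congr1 (fun u => W o0 o0 * u)).
rewrite mulr0 => <-.
have b1 := congr1 (fun u => u * W o1 o1) a1.
have b2 := congr1 (fun u => u * W o2 o1) a2.
rewrite /= in b1 b2.
transitivity (W o0 o0 * (Z o0 o0 * W o0 o1) + (2 + s) / 2 *
    (Z o0 o0 * W o1 o0 * W o1 o1 + Z o0 o0 * W o2 o0 * W o2 o1)).
  by field.
by rewrite b1 b2; field.
Qed.

(** * A factorization of size 4 from the intermediate square *)

Definition square_vertices : 'M[R]_(3, 4) := mx_of_rows 3 4
  [:: [:: 1; 1; 1; 1]; [:: 1; 0; - 1; 0]; [:: 0; 1; 0; - 1]].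

(* Barycentric coordinates, with respect to the square, of the vertices of    *)
(* the inner octagon; they are scaled to have sum 12 + 8 * s.                 *)
Definition square_coords : 'M[R]_(4, 8) :=
  let p := 5 + 4 * s in let q := 1 + s in let r := 9 + 5 * s in
  mx_of_rows 4 8
  [:: [:: p; q; 1; q; 1; q; p; r];
      [:: p; r; p; q; 1; q; 1; q];
      [:: 1; q; p; r; p; q; 1; q];
      [:: 1; q; 1; q; p; r; p; q]].

Lemma square_coordsE :
  square_vertices *m square_coords = sqcore *m (octrows 1)^T.
Proof. entries. Qed.

Lemma octagon_sqr_factorization4 :
  nonneg_factorization (octagon_mx R ^+ 2) 4.
Proof.
case/andP: sqrt2_bounds => s_lo s_hi.
exists (octrows 0 *m square_vertices), square_coords; split.
- by move=> [i +] [j +]; expand_entries i j; lra.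
- by move=> [i +] [j +]; expand_entries i j; lra.
- by rewrite octagon_mx_sqrE -!mulmxA square_coordsE.
Qed.

Lemma nonneg_rank_octagon_sqr : nonneg_rank (octagon_mx R ^+ 2) = 4%N.
Proof.
have [fac rmin] := nonneg_rankP octagon_mx_sqr_ge0.
have le4 := rmin _ octagon_sqr_factorization4.
have ge3 : (3 <= nonneg_rank (octagon_mx R ^+ 2))%N.
  case: fac => U [V [_ _ UV]]; rewrite -{1}mxrank_octagon_sqr {1}UV.
  exact: leq_trans (mxrankM_maxl _ _) (rank_leq_col _).
apply/eqP; rewrite eqn_leq le4 ltn_neqAle ge3 andbT; apply/eqP => r3.
by move: fac; rewrite -r3; apply: octagon_sqr_no_factorization3.
Qed.

End Octagon.

Theorem mainTheorem8 (R : realType) :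
  [/\ \rank (octagon_mx R) = 3%N,
      nonneg_rank (octagon_mx R ^+ 2) = 4%N
    & ~ (forall (n : nat) (B : 'M[R]_n),
           nonneg_mx B -> (nonneg_rank (B ^+ 2) <= \rank B)%N)].
Proof.
split; [exact: mxrank_octagon | exact: nonneg_rank_octagon_sqr |].
move=> /(_ _ _ (@octagon_mx_ge0 R)).
by rewrite nonneg_rank_octagon_sqr mxrank_octagon.
Qed.
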